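(* Let $d\geqslant 3$ be an integer, let $\epsilon\in(0,1)$ and let $h>0$. There exist positive constants $c$ and $C$, depending only on $d$, $h$ and $\epsilon$, such that for every metric space $\mathcal{M}=(M,\varrho)$ and every $d$-regular graph $G$ with Cheeger constant $h(G)=h$, $$c\,\gamma(G,\varrho^{1-\epsilon})\leqslant\max\{1,\gamma(G,\varrho)\}\qquad\text{and}\qquad\gamma(G,\varrho)\leqslant C\,\gamma(G,\varrho^{1-\epsilon})^{\frac{1}{1-\epsilon}}.$$ In particular, for any fixed $\epsilon\in(0,1)$ and any metric space $\mathcal{M}=(M,\varrho)$, if $(G_i)_{i\in I}$ is a family of regular graphs whose degrees are at least $3$ and uniformly bounded above and whose Cheeger constants are uniformly bounded below by a positive constant, then $\sup_{i\in I}\gamma(G_i,\varrho)<\infty$ if and only if $\sup_{i\in I}\gamma(G_i,\varrho^{1-\epsilon})<\infty$.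
   Context: All graphs are finite and simple; $V_G$ and $E_G$ denote the vertex set and edge set of a graph $G$. For a $d$-regular graph $G$, a metric space $\mathcal{M}=(M,\varrho)$ and an exponent $p>0$, $\gamma(G,\varrho^p)$ denotes the smallest constant $\gamma\in(0,\infty]$ such that for every $f\colon V_G\to M$, $$\frac{1}{|V_G|^2}\sum_{v,u\in V_G}\varrho\big(f(v),f(u)\big)^p\leqslant\frac{\gamma}{|E_G|}\sum_{\{v,u\}\in E_G}\varrho\big(f(v),f(u)\big)^p,$$ where the left-hand sum is over all ordered pairs $(v,u)\in V_G\times V_G$. The metric space $(M,\varrho^{1-\epsilon})$ is called the $\epsilon$-snowflake of $\mathcal{M}$. The Cheeger constant of $G$ is $$h(G):=\min_{\emptyset\neq S\subseteq V_G,\ |S|\leqslant |V_G|/2}\frac{\big|\big\{\{v,u\}\in E_G\colon v\in S,\ u\notin S\big\}\big|}{|S|}.$$ *)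

(* Defs.v *)
From mathcomp Require Export all_boot all_order all_algebra.
From mathcomp Require Export all_classical all_reals all_analysis.

Set Implicit Arguments.
Unset Strict Implicit.
Unset Printing Implicit Defensive.

Import Order.TTheory GRing.Theory Num.Theory.

Local Open Scope ring_scope.

Record sgraph := SGraph {
  vertex :> finType ;
  adj : rel vertex ;
  adj_sym : symmetric adj ;
  adj_irrefl : irreflexive adj }.

Definition edges (G : sgraph) : {set {set G}} :=
  [set A : {set G} | [exists v, exists u, adj v u && (A == [set v; u])]]%SET.

Definition edge_boundary (G : sgraph) (S : {set G}) : {set {set G}} :=
  [set A : {set G} |
    [exists v in S, exists u in ~: S, adj v u && (A == [set v; u])]]%SET.

Definition regular (d : nat) (G : sgraph) : Prop := forall v : G, #|adj v| = d.

(* A minimum over no set at all is +oo; since {v} is an admissible S as soon as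
   #|G| >= 2, this happens only when G has at most one vertex. *)
Definition cheeger (R : realType) (G : sgraph) : \bar R :=
  \big[Order.min/+oo%E]_(S : {set G} | (S != finset.set0) && (#|S|.*2 <= #|G|)%N)
    (#|edge_boundary S|%:R / #|S|%:R)%:E.

(* The sum over unordered edges {v, u} of a symmetric F: summing over ordered
   adjacent pairs counts every edge twice. *)
Definition edge_sum (R : realType) (G : sgraph) (F : G -> G -> R) : R :=
  2^-1 * \sum_(v : G) \sum_(u : G | adj v u) F v u.

Definition poincare_ineq (R : realType) (M : metricType R) (p : R)
    (G : sgraph) (g : R) : Prop :=
  forall f : G -> M,
    (#|G|%:R ^+ 2)^-1 * \sum_(v : G) \sum_(u : G) mdist (f v) (f u) `^ p
    <= g / #|edges G|%:R * edge_sum (fun v u => mdist (f v) (f u) `^ p).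

(* gamma(G, rho^p) for rho the distance of M.  It is +oo when no finite constant
   works.  It is an infimum rather than a minimum because, when M has at most
   one point, every g > 0 works and there is no smallest one (the value is then
   0); as soon as some f has a nonzero left-hand side the infimum is attained. *)
Definition gamma (R : realType) (M : metricType R) (p : R) (G : sgraph)
    : \bar R :=
  ereal_inf [set g%:E | g in [set g : R | 0 < g /\ poincare_ineq M p G g]]%classic.

(* Main.v *)
Require Import Defs.
From mathcomp Require Import ring lra zify.

Set Implicit Arguments.
Unset Strict Implicit.
Unset Printing Implicit Defensive.

Import Order.TTheory GRing.Theory Num.Theory.

Local Open Scope ring_scope.

(* Write q = 1 - eps, and let a be the average of rho^q over the edges. For a
   vertex v0, the real function rho(f(.), f(v0))^p is 1-Lipschitz for rho^p, so
   the L1 form of Cheeger's inequality bounds its mean by its median plus a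
   multiple of the average of rho^p over the edges. Hence it is enough to find
   a small ball of M that contains half of the values of f.
   From rho to rho^q: take such a ball of smallest radius r. Collapsing f to the
   centre outside a concentric ball of radius comparable to r, at a level that
   few edges cross, gives a map whose average edge length is O(r^(1-q) a). By the
   inequality for rho, most of the values of f lie in a ball of radius
   O(gamma r^(1-q) a), and minimality of r forces r^q = O(gamma a).
   From rho^q to rho: by concavity the inequality for rho^q gives a ball of radius
   O(gamma^(1/q) A), with A the average edge length; since gamma >= 1/2, the term
   O(A) coming from Cheeger's inequality is absorbed. *)

(** * Cut edges, incidences and sums over edges *)

(** A cut edge has exactly one endpoint in [S], so the unordered pair determines its orientation. *)
Lemma cut_pair_inj (T : finType) (v u v' u' : T) (S : {set T}) :
  v \in S -> u \notin S -> v' \in S -> u' \notin S ->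
  [set v; u]%SET = [set v'; u']%SET -> (v, u) = (v', u').
Proof.
move=> vS uS vS' uS' /setP e.
have := e v; rewrite !inE eqxx /=.
case: (eqVneq v u') => [vu|_]; first by rewrite -vu vS in uS'.
rewrite orbF => /esym/eqP <-.
have := e u; rewrite !inE eqxx orbT.
case: (eqVneq u v') => [uv|_]; first by rewrite uv vS' in uS.
by rewrite /= => /esym/eqP ->.
Qed.

(** Each boundary edge is met once leaving [S] and once entering it; the factor [2^-1] in [edge_sum]
    compensates. *)
Lemma edge_sum_cut (R : realType) (G : sgraph) (S : {set G}) :
  edge_sum (fun v u => ((v \in S) != (u \in S))%:R) = #|edge_boundary S|%:R :> R.
Proof.
pose P := [set p : G * G | [&& p.1 \in S, p.2 \notin S & adj p.1 p.2]]%SET.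
have -> : edge_boundary S = [set [set p.1; p.2]%SET | p in P]%SET.
  apply/setP => A; rewrite inE; apply/existsP/imsetP.
    case=> v /andP[vS /existsP[u /andP[]]]; rewrite inE => uS /andP[vu /eqP ->].
    by exists (v, u) => //; rewrite inE /= vS uS vu.
  case=> -[v u]; rewrite inE /= => /and3P[vS uS vu] ->.
  by exists v; rewrite vS /=; apply/existsP; exists u; rewrite inE uS vu eqxx.
rewrite card_in_imset; last first.
  move=> [v u] [v' u']; rewrite !inE /= => /and3P[vS uS _] /and3P[vS' uS' _].
  exact: cut_pair_inj vS uS vS' uS'.
pose F v u : R := ((v \in S) && (u \notin S))%:R.
have FE : \sum_v \sum_(u | adj v u) F v u = #|P|%:R.
  rewrite pair_big_dep /= -sum1_card natr_sum [LHS]big_mkcond [RHS]big_mkcond.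
  apply: eq_bigr => -[v u] _; rewrite inE /F /=.
  by case: (v \in S); case: (u \in S); case: (adj v u).
have FE' : \sum_v \sum_(u | adj v u) F u v = #|P|%:R.
  rewrite -FE (exchange_big_dep predT) //=; apply: eq_bigr => v _.
  by apply: eq_bigl => u; rewrite adj_sym.
rewrite /edge_sum (eq_bigr (fun v => \sum_(u | adj v u) F v u + \sum_(u | adj v u) F u v)).
  by rewrite big_split /= FE FE'; field.
move=> v _; rewrite -big_split /=; apply: eq_bigr => u _; rewrite /F.
by case: (v \in S); case: (u \in S); rewrite /= ?addr0 ?add0r.
Qed.

(** Double counting of incidences: irreflexivity gives every edge two endpoints, and the edges at
    [v] are the injective image of its neighbours. *)
Lemma card_edges (G : sgraph) (d : nat) :
  regular d G -> (#|edges G|.*2 = #|G| * d)%N.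
Proof.
move=> rG.
have -> : (#|edges G|.*2 = \sum_(A in edges G) \sum_(v in A) 1)%N.
  rewrite -muln2 -sum_nat_const; apply: eq_bigr => A.
  rewrite inE sum1_card => /existsP[v /existsP[u /andP[vu /eqP->]]].
  rewrite cards2; case: eqVneq => // e; by rewrite e adj_irrefl in vu.
rewrite (exchange_big_dep predT) //= -sum_nat_const; apply: eq_bigr => v _.
rewrite -(rG v) sum1_card.
rewrite -(@card_in_imset _ _ (fun u => [set v; u]%SET) (adj v)).
  apply: eq_card => A; transitivity ((A \in edges G) && (v \in A)) => //.
  rewrite inE; apply/andP/imsetP.
    case=> /existsP[x /existsP[u /andP[xu /eqP->]]]; rewrite !inE => /orP[] /eqP e.
      by exists u; [rewrite -[_ \in _]/(adj v u) e | rewrite e].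
    by exists x; [rewrite -[_ \in _]/(adj v x) e adj_sym | rewrite e finset.setUC].
  case=> u vu ->; split; last by rewrite !inE eqxx.
  by apply/existsP; exists v; apply/existsP; exists u; rewrite eqxx andbT.
move=> u w vu _ /setP e.
have := e u; rewrite !inE eqxx orbT.
case: eqVneq => [uv|_ /esym/eqP//].
by have : adj v u := vu; rewrite uv adj_irrefl.
Qed.

(** * Layer-cake decomposition and the co-area formula *)

(** A finite form of integrating the indicators of t <= g over t > 0; the pairs are a weight and a
    threshold. The induction is on the size of the support, which shrinks when the smallest nonzero
    value is subtracted from all nonzero values. *)
Lemma layer_cake (R : realType) (T : finType) (g : T -> R) :
  (forall v, 0 <= g v) ->
  exists s : seq (R * R), (forall p, p \in s -> 0 < p.1 /\ 0 < p.2) /\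
    (forall v, g v = \sum_(p <- s) p.1 * (p.2 <= g v)%R%:R).
Proof.
have [n] := ubnP #|[pred v | g v != 0]|; elim: n g => // n IH g gn g0.
case: (pickP [pred v | g v != 0]) => [v0 /= gv0 | gE]; last first.
  exists [::]; split=> // v; rewrite big_nil.
  by have := gE v; rewrite /= => /negbFE/eqP.
pose w := [arg min_(w < v0 | g w != 0) g w]%O.
have [gw minw] : g w != 0 /\ forall v, g v != 0 -> g w <= g v.
  by rewrite /w; case: arg_minP.
set m := g w in gw minw.
have m0 : 0 < m by rewrite lt_neqAle eq_sym gw /m g0.
pose g' v := if g v == 0 then 0 else g v - m.
have [||s [s_gt0 sE]] := IH g'.
- rewrite -ltnS; apply: leq_trans gn; rewrite ltnS; apply: proper_card.
  apply/properP; split; first by apply/fintype.subsetP => v; rewrite !inE /g'; case: (eqVneq (g v) 0) => //; rewrite eqxx.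
  by exists w; rewrite !inE // /g' -/m (negbTE gw) subrr eqxx.
- by move=> v; rewrite /g'; case: eqVneq => // gv; rewrite subr_ge0 minw.
(* Going back from [g'] to [g] raises every threshold by [m]; where [g] vanishes no positive
   threshold is reached. *)
exists ((m, m) :: [seq (p.1, p.2 + m) | p <- s]); split.
  move=> p; rewrite inE => /predU1P[->//|/mapP[p' /s_gt0[p1 p2] ->]].
  by split=> //=; rewrite addr_gt0.
move=> v; rewrite big_cons big_map /=.
case: (eqVneq (g v) 0) => gv.
  rewrite gv leNgt m0 mulr0 add0r big_seq big1// => p /s_gt0[_ p2].
  by rewrite leNgt addr_gt0 //= mulr0.
rewrite minw // mulr1.
have := sE v; rewrite {1}/g' (negbTE gv) => /eqP; rewrite subr_eq addrC => /eqP {1}->.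
congr (_ + _); apply: eq_bigr => p _.
by rewrite /g' (negbTE gv) lerBrDr.
Qed.

Lemma edge_sumD (R : realType) (G : sgraph) (F F' : G -> G -> R) :
  edge_sum (fun v u => F v u + F' v u) = edge_sum F + edge_sum F'.
Proof.
rewrite /edge_sum -mulrDr -big_split /=; congr (_ * _); apply: eq_bigr => v _.
by rewrite big_split.
Qed.

Lemma edge_sumZ (R : realType) (G : sgraph) (c : R) (F : G -> G -> R) :
  edge_sum (fun v u => c * F v u) = c * edge_sum F.
Proof.
rewrite /edge_sum [RHS]mulrCA; congr (_ * _); rewrite mulr_sumr; apply: eq_bigr => v _.
by rewrite mulr_sumr.
Qed.

Lemma edge_sum_const (R : realType) (G : sgraph) (d : nat) (c : R) :
  regular d G -> edge_sum (fun v u : G => c) = c * #|edges G|%:R.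
Proof.
move=> rG; rewrite /edge_sum.
under eq_bigr => v _ do rewrite sumr_const (rG v).
rewrite sumr_const -mulrnA [(d * _)%N]mulnC -(card_edges rG).
by rewrite -[c *+ _]mulr_natr -muln2 natrM; field.
Qed.

Lemma le_edge_sum (R : realType) (G : sgraph) (F F' : G -> G -> R) :
  (forall v u, adj v u -> F v u <= F' v u) -> edge_sum F <= edge_sum F'.
Proof.
move=> FF'; rewrite /edge_sum ler_wpM2l ?invr_ge0 //.
by apply: ler_sum => v _; apply: ler_sum => u; exact: FF'.
Qed.

Lemma edge_sum_ge0 (R : realType) (G : sgraph) (F : G -> G -> R) :
  (forall v u, 0 <= F v u) -> 0 <= edge_sum F.
Proof.
by move=> F0; rewrite mulr_ge0 ?invr_ge0//; apply: sumr_ge0 => v _; apply: sumr_ge0.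
Qed.

Lemma edge_sum_bigsum (R : realType) (G : sgraph) (I : Type) (s : seq I)
    (F : I -> G -> G -> R) :
  edge_sum (fun v u => \sum_(i <- s) F i v u) = \sum_(i <- s) edge_sum (F i).
Proof.
elim: s => [|i s IH].
  rewrite big_nil /edge_sum big1 ?mulr0// => v _; rewrite big1// => u _.
  by rewrite big_nil.
rewrite big_cons -IH -edge_sumD /edge_sum; congr (_ * _).
by apply: eq_bigr => v _; apply: eq_bigr => u _; rewrite big_cons.
Qed.

Definition superlevel (R : realType) (T : finType) (g : T -> R) (t : R) : {set T} :=
  [set v | t <= g v]%SET.

(** The difference of two values of [g] is the total weight of the superlevel sets that separate the
    two vertices; summing over edges turns each separation into a boundary count. *)
Lemma coarea (R : realType) (G : sgraph) (g : G -> R) :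
  (forall v, 0 <= g v) ->
  exists s : seq (R * R), [/\ forall p, p \in s -> 0 < p.1 /\ 0 < p.2,
    forall v, g v = \sum_(p <- s) p.1 * (v \in superlevel g p.2)%:R &
    edge_sum (fun v u => `|g v - g u|) =
      \sum_(p <- s) p.1 * #|edge_boundary (superlevel g p.2)|%:R].
Proof.
move=> g0; have [s [s0 sE]] := layer_cake g0; exists s; split=> //.
  by move=> v; rewrite {1}sE; apply: eq_bigr => p _; rewrite inE.
have key v u : `|g v - g u| = \sum_(p <- s)
    p.1 * ((v \in superlevel g p.2) != (u \in superlevel g p.2))%:R.
  wlog vu : v u / g u <= g v.
    move=> H; case: (leP (g u) (g v)) => [/H//|/ltW/H]; rewrite distrC => ->.
    by apply: eq_bigr => p _; rewrite eq_sym.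
  rewrite ger0_norm ?subr_ge0// {1}(sE v) {1}(sE u) -sumrB.
  apply: eq_bigr => p _; rewrite !inE -mulrBr.
  case: (leP p.2 (g u)) => pu; first by rewrite (le_trans pu vu) subrr.
  by case: (leP p.2 (g v)) => _; rewrite /= subr0.
rewrite (_ : edge_sum _ = edge_sum (fun v u : G => \sum_(p <- s)
    p.1 * ((v \in superlevel g p.2) != (u \in superlevel g p.2))%:R)).
  rewrite edge_sum_bigsum; apply: eq_bigr => p _.
  by rewrite edge_sumZ edge_sum_cut.
by rewrite /edge_sum; congr (_ * _); apply: eq_bigr => v _; apply: eq_bigr => u _.
Qed.

(** * The L1 form of Cheeger's inequality *)

Lemma dist_max_le (R : realType) (x y c : R) :
  `|Num.max x c - Num.max y c| <= `|x - y|.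
Proof.
have := ler_norm (x - y); have := ler_norm (y - x); rewrite distrC ler_norml.
by case: (leP x c) => ?; case: (leP y c) => ?; lra.
Qed.

Lemma dist_min_le (R : realType) (x y c : R) :
  `|Num.min x c - Num.min y c| <= `|x - y|.
Proof.
have := ler_norm (x - y); have := ler_norm (y - x); rewrite distrC ler_norml.
by case: (leP x c) => ?; case: (leP y c) => ?; lra.
Qed.

Lemma cheeger_boundary (R : realType) (G : sgraph) (h : R) (S : {set G}) :
  (h%:E <= cheeger R G)%E -> (#|S|.*2 <= #|G|)%N ->
  h * #|S|%:R <= #|edge_boundary S|%:R.
Proof.
move=> hG Sn; case: (eqVneq S finset.set0) => [->|S0].
  by rewrite cards0 mulr0.
have hS : (h%:E <= (#|edge_boundary S|%:R / #|S|%:R)%:E)%E.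
  by apply: (le_trans hG); apply: bigmin_le_cond; rewrite S0.
by rewrite lee_fin ler_pdivlMr ?ltr0n ?card_gt0 in hS.
Qed.

(** Superlevel sets at positive thresholds lie in the support of [g], so each contains at most half
    of the vertices; the isoperimetric bound is summed over levels by [coarea]. *)
Lemma cheeger_L1 (R : realType) (G : sgraph) (h : R) (g : G -> R) :
  (h%:E <= cheeger R G)%E -> (forall v, 0 <= g v) ->
  (#|[set v | (0 < g v)%R]%SET|.*2 <= #|G|)%N ->
  h * \sum_v g v <= edge_sum (fun v u => `|g v - g u|).
Proof.
move=> hG g0 gn; have [s [s0 gE ->]] := coarea g0.
rewrite (eq_bigr _ (fun v _ => gE v)) exchange_big /= mulr_sumr big_seq [leRHS]big_seq.
apply: ler_sum => p /s0[p1 p2].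
rewrite -mulr_sumr mulrCA ler_wpM2l ?(ltW p1)//.
rewrite -natr_sum -big_mkcond /= sum1_card; apply: cheeger_boundary => //.
apply: leq_trans gn; rewrite leq_double; apply: subset_leq_card.
by apply/fintype.subsetP => v; rewrite !inE; apply: lt_le_trans.
Qed.

(** Apply [cheeger_L1] to the positive part of [g - m], whose variation along edges is no larger
    than that of [g]. *)
Lemma cheeger_median (R : realType) (G : sgraph) (h m : R) (g : G -> R) :
  0 <= h -> (h%:E <= cheeger R G)%E -> (#|[set v | (m < g v)%R]%SET|.*2 <= #|G|)%N ->
  h * \sum_v g v <= h * (#|G|%:R * m) + edge_sum (fun v u => `|g v - g u|).
Proof.
move=> h0 hG gn; pose g' v := Num.max (g v - m) 0.
have g'0 v : 0 <= g' v by rewrite /g' le_max lexx orbT.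
have g'n : (#|[set v | (0 < g' v)%R]%SET|.*2 <= #|G|)%N.
  rewrite (_ : finset _ = [set v | m < g v]%SET)//.
  by apply/setP => v; rewrite !inE /g' lt_max ltxx orbF subr_gt0.
have := cheeger_L1 hG g'0 g'n.
have g_le : \sum_v g v <= #|G|%:R * m + \sum_v g' v.
  rewrite mulr_natl -sumr_const -big_split /=; apply: ler_sum => v _.
  by rewrite -lerBlDl /g' le_max lexx.
have g'_lip : edge_sum (fun v u => `|g' v - g' u|) <= edge_sum (fun v u => `|g v - g u|).
  apply: le_edge_sum => v u _; apply: le_trans (dist_max_le _ _ _) _.
  by rewrite opprD addrACA subrr addr0.
move=> H; have := ler_wpM2l h0 g_le; lra.
Qed.

(** * Concave powers and snowflaked distances *)

(** For z = x or y, the ratio z / (x + y) is at most 1, hence at most its own power [p]; multiply by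
    (x + y)^p and add. *)
Lemma powR_subadd (R : realType) (p x y : R) :
  0 < p <= 1 -> 0 <= x -> 0 <= y -> (x + y) `^ p <= x `^ p + y `^ p.
Proof.
move=> /andP[p0 p1] x0 y0.
have [s0|s_neq0] := eqVneq (x + y) 0.
  by rewrite s0 powR0 ?gt_eqF// addr_ge0 ?powR_ge0.
have s0 : 0 < x + y by rewrite lt_neqAle eq_sym s_neq0 addr_ge0.
have key z : 0 <= z -> z <= x + y -> z / (x + y) * (x + y) `^ p <= z `^ p.
  move=> z0 zs; rewrite -{2}(divfK s_neq0 z) powRM ?divr_ge0 ?(ltW s0)//.
  rewrite ler_wpM2r ?powR_ge0//.
  move: z0; rewrite le_eqVlt => /predU1P[<-|z0]; first by rewrite mul0r powR_ge0.
  by rewrite ger1_powR// divr_gt0//= ler_pdivrMr// mul1r.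
rewrite -[leLHS]mul1r -(divff s_neq0) mulrDl mulrDl.
by rewrite lerD ?key// ?lerDl ?lerDr.
Qed.

(** This converts bounded distances into snowflaked ones: split x as x^(1-q) x^q and bound the first
    factor. *)
Lemma ler_powR_interp (R : realType) (q x L : R) :
  q <= 1 -> 0 <= x -> x <= L -> x <= L `^ (1 - q) * x `^ q.
Proof.
move=> q1; rewrite le_eqVlt => /predU1P[<- _|x0 xL].
  by rewrite mulr_ge0 ?powR_ge0.
have {1}-> : x = x `^ (1 - q) * x `^ q.
  by rewrite -powRD ?(gt_eqF x0) ?implybT// subrK powRr1 ?ltW.
by rewrite ler_wpM2r ?powR_ge0// ge0_ler_powR ?subr_ge0 ?nnegrE ?(ltW x0)// (le_trans (ltW x0)).
Qed.

Section Metric.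
Context (R : realType) (M : metricType R).

Lemma mdist_powR_triangle (p : R) (x y z : M) : 0 < p <= 1 ->
  mdist x z `^ p <= mdist x y `^ p + mdist y z `^ p.
Proof.
move=> p01; apply: le_trans (powR_subadd p01 (mdist_ge0 _ _) (mdist_ge0 _ _)).
have /andP[p0 _] := p01.
by rewrite ge0_ler_powR ?(ltW p0) ?nnegrE ?addr_ge0 ?mdist_ge0 ?metric_triangle.
Qed.

(** For [p <= 1] the power of the distance is again a metric, so the distance to [f v0] varies along
    an edge by at most the length of that edge. *)
Lemma cheeger_mdist (G : sgraph) (h p m : R) (f : G -> M) (v0 : G) :
  0 <= h -> (h%:E <= cheeger R G)%E -> 0 < p <= 1 ->
  (#|[set v | (m < mdist (f v) (f v0) `^ p)%R]%SET|.*2 <= #|G|)%N ->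
  h * \sum_v mdist (f v) (f v0) `^ p <=
    h * (#|G|%:R * m) + edge_sum (fun v u => mdist (f v) (f u) `^ p).
Proof.
move=> h0 hG p01 mn; apply: le_trans (cheeger_median h0 hG mn) _.
rewrite lerD2l; apply: le_edge_sum => v u _; rewrite ler_norml.
have := mdist_powR_triangle (f v) (f u) (f v0) p01.
have := mdist_powR_triangle (f u) (f v) (f v0) p01.
by rewrite (metric_sym (f u) (f v)); lra.
Qed.

Lemma sum_mdist_center (G : sgraph) (p : R) (f : G -> M) (v0 : G) : 0 < p <= 1 ->
  \sum_v \sum_u mdist (f v) (f u) `^ p <=
    2 * #|G|%:R * \sum_v mdist (f v) (f v0) `^ p.
Proof.
move=> p01; have -> : 2 * #|G|%:R * \sum_v mdist (f v) (f v0) `^ p =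
    \sum_(v : G) \sum_(u : G) (mdist (f v) (f v0) `^ p + mdist (f u) (f v0) `^ p).
  under [RHS]eq_bigr => v _ do rewrite big_split /= sumr_const.
  by rewrite big_split /= sumr_const -sumrMnl -mulrA mulr_natl mulr2n sumrMnl !mulr_natl.
apply: ler_sum => v _; apply: ler_sum => u _.
by rewrite (metric_sym (f u)); apply: mdist_powR_triangle.
Qed.

(** The minimal radius is attained because only the finitely many distances between values of [f]
    need to be considered. *)
Lemma smallest_median_ball (T : finType) (f : T -> M) : (0 < #|T|)%N ->
  exists (v0 : T) (r : R), [/\ 0 <= r,
    (#|T| <= #|[set w | (mdist (f w) (f v0) <= r)%R]%SET|.*2)%N &
    forall v s, (#|T| <= #|[set w | (mdist (f w) (f v) <= s)%R]%SET|.*2)%N -> r <= s].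
Proof.
move=> T0; have [t0 _] : exists t0 : T, t0 \in T by apply/card_gt0P.
pose rad (p : T * T) := mdist (f p.2) (f p.1).
pose good p := (#|T| <= #|[set w | (mdist (f w) (f p.1) <= rad p)%R]%SET|.*2)%N.
(* Shrinking a ball until its radius is the distance to its farthest value loses no vertex. *)
have max_good v s : (#|T| <= #|[set w | (mdist (f w) (f v) <= s)%R]%SET|.*2)%N ->
    exists2 u, good (v, u) & rad (v, u) <= s.
  move=> vs; have [w0 w0s] : exists w0, w0 \in [set w | mdist (f w) (f v) <= s]%SET.
    by apply/card_gt0P; rewrite -double_gt0 (leq_trans T0).
  rewrite inE in w0s.
  case: (@arg_maxP _ _ _ w0 (fun w => mdist (f w) (f v) <= s) (fun w => mdist (f w) (f v)) w0s).
  move=> u us umax; exists u => //; rewrite /good; apply: leq_trans vs _.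
  rewrite leq_double; apply: subset_leq_card; apply/fintype.subsetP => w.
  by rewrite !inE => /umax.
have [|u0 good0 _] := max_good t0 (\sum_w mdist (f w) (f t0)).
  rewrite (_ : finset _ = [set: T]%SET) ?cardsT -?addnn ?leq_addr//.
  apply/setP => w; rewrite !inE (bigD1 w) //= lerDl.
  by apply: sumr_ge0 => ? _; apply: mdist_ge0.
case: (@arg_minP _ _ _ (t0, u0) good rad good0) => -[v0 u] gu umin.
exists v0, (rad (v0, u)); split=> //; first exact: mdist_ge0.
by move=> v s /max_good[w /umin]; apply: le_trans.
Qed.

End Metric.

(** * Averaging arguments and the choice of a level *)

Lemma markov_card (R : realType) (T : finType) (A : {set T}) (t : R) (g : T -> R) :
  (forall v, 0 <= g v) -> (forall v, v \in A -> t <= g v) ->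
  #|A|%:R * t <= \sum_v g v.
Proof.
move=> g0 tg; rewrite mulr_natl -sumr_const [leRHS](bigID (mem A)) /=.
by rewrite ler_wpDr ?sumr_ge0// ler_sum.
Qed.

Lemma ex_le_mean (R : realType) (T : finType) (g : T -> R) (c : R) :
  (0 < #|T|)%N -> \sum_v g v <= #|T|%:R * c -> exists v, g v <= c.
Proof.
move=> T0 gc; apply/existsP; apply: contraLR gc => /existsPn gc.
rewrite -ltNge mulr_natl -sumr_const; have /card_gt0P[t0 _] := T0.
rewrite (bigD1 t0) //= [ltRHS](bigD1 t0) //= ltr_leD ?ltNge//.
by apply: ler_sum => v _; apply: ltW; rewrite ltNge.
Qed.

(* Averaging the co-area identity over the levels in [b, 2b]. *)
Lemma coarea_level (R : realType) (G : sgraph) (g : G -> R) (b : R) : 0 < b ->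
  exists S : {set G}, [/\ forall v, v \in S -> b <= g v,
    forall v, v \notin S -> g v <= 2 * b &
    b * #|edge_boundary S|%:R <= edge_sum (fun v u => `|g v - g u|)].
Proof.
(* Truncating to the window from [b] to [2 * b] and shifting down by [b] gives values in [0, b]. *)
move=> b0; pose g' v := Num.min (Num.max (g v - b) 0) b.
have g'0 v : 0 <= g' v by rewrite /g' le_min (ltW b0) le_max lexx orbT.
have g'_lip : edge_sum (fun v u => `|g' v - g' u|) <= edge_sum (fun v u => `|g v - g u|).
  apply: le_edge_sum => v u _; apply: le_trans (dist_min_le _ _ _) _.
  by apply: le_trans (dist_max_le _ _ _) _; rewrite opprD addrACA subrr addr0.
case: (pickP [pred v | 2 * b < g v]) => [v0 /= v0b|g2b]; last first.
  exists finset.set0; split=> [v|v _|]; first by rewrite inE.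
    by rewrite leNgt; have /= -> := g2b v.
  rewrite (_ : edge_boundary _ = finset.set0) ?cards0 ?mulr0.
    by apply: edge_sum_ge0 => v u; apply: normr_ge0.
  apply/setP => A; rewrite !inE; apply/existsP => -[v]; by rewrite inE.
have g'v0 : g' v0 = b by rewrite /g'; case: (leP (g _ - b) 0) => ?; case: leP => ?; lra.
have [s [s0 gE EE]] := coarea g'0.
(* These are the thresholds at most [g' v0 = b]; their weights add up to [b]. *)
pose s' := [seq p <- s | v0 \in superlevel g' p.2].
set E' := edge_sum _ in g'_lip EE.
have sum_s' : \sum_(p <- s') p.1 = b.
  rewrite -g'v0 gE /s' big_filter [LHS]big_mkcond; apply: eq_bigr => p _.
  by case: ifP => _; rewrite ?mulr1 ?mulr0.
(* If every level in [s'] failed, the weighted sum of the excesses would be positive, as [s'] has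
   total weight [b > 0]; the co-area formula makes it at most 0. *)
have [p ps pE] : exists2 p, p \in s' & b * #|edge_boundary (superlevel g' p.2)|%:R <= E'.
  apply/hasP; apply: contraT => /hasPn H.
  have pos p : p \in s' -> 0 < p.1 * (b * #|edge_boundary (superlevel g' p.2)|%:R - E').
    move=> ps; rewrite mulr_gt0//; last by rewrite subr_gt0 ltNge H.
    by move: ps; rewrite mem_filter => /andP[_ /s0[]].
  have : \sum_(p <- s') p.1 * (b * #|edge_boundary (superlevel g' p.2)|%:R - E') <= 0.
    under eq_bigr => p _ do rewrite mulrBr mulrCA.
    rewrite sumrB -mulr_sumr -mulr_suml sum_s' subr_le0 ler_pM2l// EE /s' big_filter big_mkcond.
    rewrite big_seq [leRHS]big_seq; apply: ler_sum => p /s0[p1 _].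
    by case: ifP => // _; rewrite mulr_ge0 ?(ltW p1).
  case: (s') pos sum_s' => [|p l] pos; first by rewrite big_nil => b_eq; rewrite -b_eq ltxx in b0.
  move=> _; rewrite big_cons leNgt ltr_wpDr ?pos ?mem_head// big_seq.
  by apply: sumr_ge0 => x xl; rewrite ltW// pos// inE xl orbT.
exists (superlevel g' p.2); move: ps; rewrite mem_filter inE g'v0 => /andP[pb /s0[_ p2]].
split; last exact: le_trans g'_lip.
- move=> v; rewrite inE => vp; have : 0 < g' v by apply: lt_le_trans vp.
  by rewrite /g' lt_min lt_max ltxx orbF subr_gt0 => /andP[/ltW].
- move=> v; rewrite inE -ltNge => vp; have : g' v < b by apply: lt_le_trans pb.
  by rewrite /g'; case: (leP (g _ - b) 0) => ?; [case: (leP 0 b) | case: (leP (g v - b) b)] => ?; lra.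
Qed.

(** * Passing between the Poincare inequalities for rho and its snowflake *)

Lemma leq_setC_double (T : finType) (A : {set T}) :
  (#|T| <= #|A|.*2)%N = (#|~: A|.*2 <= #|T|)%N.
Proof. by have := cardsC A; lia. Qed.

(** A tenth plus a quarter is less than a half; [k] stands for the size of an intersection. *)
Lemma double_union_bound (i j k l N : nat) :
  (i * 10 <= N -> j * 4 <= N -> l <= i + j - k -> l.*2 <= N)%N.
Proof. lia. Qed.

(* When L^q = 40 r^q, (2 L)^(1-q) + L / (20 r^q) = cutoff_const q * r^(1-q). *)
Definition cutoff_const (R : realType) (q : R) : R :=
  (2 * 40 `^ q^-1) `^ (1 - q) + 40 `^ q^-1 / 20.

Lemma cutoff_const_gt0 (R : realType) (q : R) : 0 < cutoff_const q.
Proof. by rewrite addr_gt0 ?powR_gt0 ?divr_gt0 ?mulr_gt0 ?powR_gt0. Qed.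

Section Directions.
Context (R : realType) (M : metricType R) (G : sgraph) (d : nat) (h : R).
Hypotheses (rG : regular d G) (d0 : (0 < d)%N) (G0 : (0 < #|G|)%N).
Hypotheses (h0 : 0 < h) (hG : (h%:E <= cheeger R G)%E).

Let n : R := #|G|%:R.
Let E : R := #|edges G|%:R.

Let n0 : 0 < n. Proof. by rewrite ltr0n. Qed.

Let EE : 2 * E = n * d%:R.
Proof. by rewrite -!natrM -(card_edges rG) mul2n. Qed.

Let E0 : 0 < E.
Proof.
by rewrite ltr0n -double_gt0 (card_edges rG) muln_gt0 G0.
Qed.

(** The double average is a mean over centres, so some centre does no worse than the mean. *)
Lemma poincare_ineq_center (p g : R) (f : G -> M) : 0 < g -> poincare_ineq M p G g ->
  exists v0, \sum_u mdist (f u) (f v0) `^ p <=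
    n * (g * (edge_sum (fun v u => mdist (f v) (f u) `^ p) / E)).
Proof.
move=> g0 /(_ f) Pf; apply: ex_le_mean => //.
rewrite -/n exchange_big /= -/n.
move: Pf; rewrite mulrC ler_pdivrMr ?exprn_gt0// => /le_trans; apply.
by rewrite le_eqVlt; apply/orP; left; apply/eqP; rewrite -/n -/E; field; rewrite gt_eqF.
Qed.

(** Edges inside [S] become trivial and edges across the cut have length at most [L]. The others
    have length at most [2 * L] through [f v0], so interpolation bounds them by their snowflaked
    length. *)
Lemma collapse_edge_sum (q L : R) (f : G -> M) (v0 : G) (S : {set G}) :
  0 < q <= 1 -> 0 <= L -> (forall v, v \notin S -> mdist (f v) (f v0) <= L) ->
  edge_sum (fun v u => mdist (f (if v \in S then v0 else v))
                             (f (if u \in S then v0 else u)) `^ 1) <=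
  (2 * L) `^ (1 - q) * edge_sum (fun v u => mdist (f v) (f u) `^ q)
    + L * #|edge_boundary S|%:R.
Proof.
move=> /andP[q0 q1] L0 fL; rewrite -edge_sum_cut -!edge_sumZ -edge_sumD.
apply: le_edge_sum => v u _; rewrite powRr1 ?mdist_ge0//.
have pos : 0 <= (2 * L) `^ (1 - q) * mdist (f v) (f u) `^ q by rewrite mulr_ge0 ?powR_ge0.
case: (boolP (v \in S)) => vS; case: (boolP (u \in S)) => uS /=.
- by rewrite mdistxx mulr0 addr0.
- by rewrite mulr1 metric_sym (le_trans (fL _ uS))// lerDr.
- by rewrite mulr1 (le_trans (fL _ vS))// lerDr.
rewrite mulr0 addr0 ler_powR_interp ?mdist_ge0//.
apply: le_trans (metric_triangle _ (f v0) _) _.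
by rewrite mulr_natl mulr2n lerD ?fL// metric_sym fL.
Qed.

(* A smallest ball that contains half of the vertices cannot be large: cut f off
   outside a concentric ball of comparable radius. The edges of the new map have
   average length O(r^(1-q) a), so (M, rho) puts most vertices in a ball of
   radius r/2. *)
Lemma median_radius_bound (q g r : R) (f : G -> M) (v0 : G) :
  0 < q < 1 -> 0 < g -> poincare_ineq M 1 G g -> 0 <= r ->
  (#|G| <= #|[set w | (mdist (f w) (f v0) <= r)%R]%SET|.*2)%N ->
  (forall v s, (#|G| <= #|[set w | (mdist (f w) (f v) <= s)%R]%SET|.*2)%N -> r <= s) ->
  r `^ q <= (8 * cutoff_const q + d%:R / h) * Num.max 1 g *
    (edge_sum (fun v u => mdist (f v) (f u) `^ q) / E).
Proof.
move=> /andP[q0 q1] g0 Pg r0 v0r rmin.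
have q01 : 0 < q <= 1 by rewrite q0 ltW.
set e := edge_sum _.
have e0 : 0 <= e by apply: edge_sum_ge0 => v u; apply: powR_ge0.
set a := e / E.
have a0 : 0 <= a by rewrite divr_ge0// ltW.
have aE : e / E = a by [].
have eE : e = a * E by rewrite divfK// gt_eqF.
clearbody a.
set c := 40 `^ q^-1.
have c0 : 0 < c by rewrite powR_gt0.
have K0 := cutoff_const_gt0 q.
set g1 := Num.max 1 g.
have g1_ge1 : 1 <= g1 by rewrite le_max lexx.
have gg1 : g <= g1 by rewrite le_max lexx orbT.
have dh0 : 0 < d%:R / h by rewrite divr_gt0 ?ltr0n.
rewrite leNgt; apply/negP => big.
set x := r `^ q in big *.
(* The negated goal is split in two: [x_g] will control the collapsed map, [x_d] the error term in
   Cheeger's inequality. *)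
have [x_g x_d] : 8 * cutoff_const q * (g * a) <= x /\ d%:R / h * a <= x.
  split; apply: (le_trans _ (ltW big)).
    rewrite -[leRHS]mulrA; apply: ler_pM; rewrite ?mulr_ge0 ?(ltW K0) ?(ltW g0)//.
      by rewrite lerDl ltW.
    by rewrite ler_wpM2r.
  rewrite -[leRHS]mulrA; apply: ler_pM => //; first exact: ltW.
    by rewrite lerDr mulr_ge0 ?ltW.
  by rewrite ler_peMl.
have x0 : 0 < x.
  apply: le_lt_trans big; rewrite !mulr_ge0// ?addr_ge0 ?(ltW dh0) ?mulr_ge0 ?(ltW K0)//.
  exact: le_trans g1_ge1.
have r_gt0 : 0 < r by apply: gt0_powR x0.
(* The median contributes [x] per vertex, and the Cheeger term at most [x / 2]. *)
have sumf : \sum_v mdist (f v) (f v0) `^ q <= 2 * n * x.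
  rewrite leq_setC_double in v0r.
  rewrite -(ler_pM2l h0); apply: le_trans (@cheeger_mdist _ _ _ h q x _ v0 (ltW h0) hG q01 _) _.
    apply: leq_trans v0r; rewrite leq_double; apply: subset_leq_card.
    apply/fintype.subsetP => v; rewrite !inE -ltNge; apply: contraTT.
    rewrite -!leNgt => vr.
    by rewrite ge0_ler_powR ?nnegrE ?mdist_ge0// ltW.
  rewrite -/e -/n eE.
  have := ler_wpM2l (ltW h0) x_d.
  have -> : h * (d%:R / h * a) = d%:R * a by field; rewrite gt_eqF.
  move=> dx.
  have := ler_wpM2l (ltW n0) dx.
  have := mulr_ge0 (ltW n0) (ltW (mulr_gt0 h0 x0)).
  have -> : a * E = (n * d%:R) * a / 2 by rewrite -EE; field.
  lra.
(* Since the mean is at most [2 * x], at most a tenth of the vertices lie above [20 * x]. The chosen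
   level stays below [2 * b = 40 * x], which is the power [q] of the radius [L] below. *)
pose b := 20 * x; have b0 : 0 < b by rewrite mulr_gt0.
have [S [bS Sb ES]] := @coarea_level _ _ (fun v => mdist (f v) (f v0) `^ q) b b0.
have {}ES : b * #|edge_boundary S|%:R <= e.
  apply: le_trans ES _; apply: le_edge_sum => v u _; rewrite ler_norml.
  have := mdist_powR_triangle (f v) (f u) (f v0) q01.
  have := mdist_powR_triangle (f u) (f v) (f v0) q01.
  by rewrite (metric_sym (f u) (f v)); lra.
have Sn : #|S|%:R * 10 <= n.
  have := markov_card (fun v => powR_ge0 _ _) bS.
  move=> /le_trans /(_ sumf); rewrite /b => Sx.
  by rewrite -(ler_pM2r x0); lra.
pose L := c * r.
have L0 : 0 <= L by rewrite mulr_ge0// ltW.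
have SL v : v \notin S -> mdist (f v) (f v0) <= L.
  move=> /Sb vb; have := powRrM (mdist (f v) (f v0)) q q^-1.
  rewrite mulfV ?gt_eqF// powRr1 ?mdist_ge0// => ->.
  have -> : L = (2 * b) `^ q^-1.
    rewrite /b mulrA -natrM powRM ?(ltW x0)// /x -powRrM mulfV ?gt_eqF//.
    by rewrite powRr1.
  by rewrite ge0_ler_powR ?nnegrE ?powR_ge0 ?invr_ge0 ?(ltW q0)// mulr_ge0// ltW.
pose pi v := if v \in S then v0 else v.
have [v1] := poincare_ineq_center (f \o pi) g0 Pg.
have rq : r `^ (1 - q) * x = r by rewrite -powRD ?subrK ?powRr1 ?(gt_eqF r_gt0) ?implybT.
have /= fpi := collapse_edge_sum q01 L0 SL.
have {}fpi : edge_sum (fun v u => mdist (f (pi v)) (f (pi u)) `^ 1) <= cutoff_const q * r `^ (1 - q) * e.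
  apply: le_trans fpi _; rewrite -/e /cutoff_const -/c.
  have -> : (2 * L) `^ (1 - q) = (2 * c) `^ (1 - q) * r `^ (1 - q).
    by rewrite /L mulrA powRM// mulr_ge0// ltW.
  (* The boundary of [S] has at most [e / b] edges, so crossing edges cost at most [L / b] times
     [e]. *)
  have -> : L = c / 20 * r `^ (1 - q) * b by rewrite /L /b -{1}rq; field.
  rewrite -[in leLHS](mulrA _ b) !mulrDl lerD2l ler_wpM2l// mulr_ge0 ?powR_ge0//.
  by rewrite divr_ge0// ltW.
move=> /= center.
(* The factor 8 in the constant is chosen to give mean distance [r / 8] here. *)
have {}center : \sum_u mdist (f (pi u)) (f (pi v1)) <= n * r / 8.
  under eq_bigr => u _ do rewrite -(powRr1 (mdist_ge0 _ _)).
  apply: le_trans center _; rewrite -mulrA ler_pM2l//.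
  have : g * (edge_sum (fun v u => mdist (f (pi v)) (f (pi u)) `^ 1) / E) <=
      r `^ (1 - q) / 8 * (8 * cutoff_const q * (g * a)).
    have -> : r `^ (1 - q) / 8 * (8 * cutoff_const q * (g * a)) = g * (cutoff_const q * r `^ (1 - q) * e / E).
      by rewrite -aE; field; rewrite gt_eqF.
    by rewrite ler_pM2l// ler_pM2r ?invr_gt0.
  move=> /le_trans; apply.
  have -> : r / 8 = r `^ (1 - q) / 8 * x by rewrite -{1}rq mulrAC.
  by rewrite ler_wpM2l// divr_ge0 ?powR_ge0.
(* After collapsing, at most a quarter of the vertices are farther than [r / 2] from the centre, and
   at most a tenth were collapsed. So a ball of radius [r / 2] holds half of the values of [f],
   against minimality. *)
have : r <= r / 2.
  apply: (rmin (pi v1)); rewrite leq_setC_double.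
  pose A := [set w | r / 2 < mdist (f (pi w)) (f (pi v1))]%SET.
  have An : #|A|%:R * (r / 2) <= n * r / 8.
    apply: le_trans center; apply: markov_card => v; first exact: mdist_ge0.
    by rewrite inE => /ltW.
  have {}An : #|A|%:R * 4 <= n by rewrite -(ler_pM2r r_gt0); lra.
  have : (#|~: [set w | (mdist (f w) (f (pi v1)) <= r / 2)%R]%SET| <= #|S :|: A|)%N.
    apply: subset_leq_card; apply/fintype.subsetP => v; rewrite !inE -ltNge /pi.
    by case: (v \in S) => //=.
  rewrite cardsU => SA.
  by apply: double_union_bound SA; rewrite -(ler_nat R) natrM.
lra.
Qed.

(** The radius bound and Cheeger's inequality control the mean of rho^q to the centre of the
    smallest median ball. The maximum with 1 absorbs the Cheeger term, which does not contain [g];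
    the outer 2 comes from passing from the centre to pairs. *)
Lemma snowflake_poincare (q g : R) : 0 < q < 1 -> 0 < g -> poincare_ineq M 1 G g ->
  poincare_ineq M q G (2 * (8 * cutoff_const q + 2 * (d%:R / h)) * Num.max 1 g).
Proof.
move=> q01 g0 Pg f; have /andP[q0 q1] := q01.
have q01' : 0 < q <= 1 by rewrite q0 ltW.
have [v0 [r [r0 v0r rmin]]] := smallest_median_ball f G0.
have := median_radius_bound q01 g0 Pg r0 v0r rmin.
set e := edge_sum _; set a := e / E; set g1 := Num.max 1 g; rewrite mulrDl => rb.
have a0 : 0 <= a.
  by rewrite divr_ge0 ?(ltW E0)//; apply: edge_sum_ge0 => v u; apply: powR_ge0.
have sumf : \sum_v mdist (f v) (f v0) `^ q <= n * (r `^ q + d%:R / h * a).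
  rewrite leq_setC_double in v0r.
  rewrite -(ler_pM2l h0); apply: le_trans (@cheeger_mdist _ _ _ h q (r `^ q) _ v0 (ltW h0) hG q01' _) _.
    apply: leq_trans v0r; rewrite leq_double; apply: subset_leq_card.
    apply/fintype.subsetP => v; rewrite !inE -ltNge; apply: contraTT.
    rewrite -!leNgt => vr.
    by rewrite ge0_ler_powR ?nnegrE ?mdist_ge0// ltW.
  rewrite -/e -/n mulrDr mulrDr lerD2l.
  have -> : h * (n * (d%:R / h * a)) = 2 * (a * E).
    by rewrite [RHS]mulrCA EE; field; rewrite gt_eqF.
  have -> : a * E = e by rewrite /a divfK// gt_eqF.
  have : 0 <= e by apply: edge_sum_ge0 => v u; apply: powR_ge0.
  by lra.
have g1a : a <= g1 * a by rewrite ler_peMl// le_max lexx.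
rewrite mulrC ler_pdivrMr ?exprn_gt0// -/n.
apply: le_trans (sum_mdist_center _ v0 q01') _; rewrite -/n -/E -/e.
have -> : 2 * (8 * cutoff_const q + 2 * (d%:R / h)) * g1 / E * e * n ^+ 2 =
    2 * n * (n * ((8 * cutoff_const q + 2 * (d%:R / h)) * (g1 * a))).
  by rewrite /a; move: (8 * cutoff_const q + _) => k; field; rewrite gt_eqF.
rewrite ler_wpM2l ?mulr_ge0 ?(ltW n0)//; apply: le_trans sumf _.
rewrite ler_wpM2l ?(ltW n0)//.
have := ler_wpM2l (divr_ge0 (ler0n R d) (ltW h0)) g1a.
by move: rb; rewrite -/a; lra.
Qed.

(* Pointwise, x^q <= B^q + x B^(q-1); this replaces Jensen's inequality. *)
Lemma edge_sum_powR_le (q B : R) (f : G -> M) : 0 < q < 1 -> 0 < B ->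
  edge_sum (fun v u => mdist (f v) (f u) `^ 1) <= B * E ->
  edge_sum (fun v u => mdist (f v) (f u) `^ q) <= 2 * B `^ q * E.
Proof.
move=> /andP[q0 q1] B0 eB.
have Bq0 : 0 < B `^ (1 - q) by rewrite powR_gt0.
apply: (@le_trans _ _ (edge_sum (fun v u : G =>
    B `^ q + (B `^ (1 - q))^-1 * mdist (f v) (f u) `^ 1))).
  apply: le_edge_sum => v u _; rewrite powRr1 ?mdist_ge0//.
  set x := mdist _ _; have x0 : 0 <= x := mdist_ge0 _ _.
  case: (leP x B) => xB.
    by rewrite ler_wpDr ?mulr_ge0 ?invr_ge0 ?(ltW Bq0)// ge0_ler_powR ?nnegrE// ltW.
  have x_gt0 := lt_trans B0 xB.
  rewrite ler_wpDl ?powR_ge0// ler_pdivlMl//.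
  have {2}-> : x = x `^ (1 - q) * x `^ q.
    by rewrite -powRD ?(gt_eqF x_gt0) ?implybT// subrK powRr1.
  by rewrite ler_wpM2r ?powR_ge0// ge0_ler_powR ?nnegrE ?subr_ge0 ?ltW.
rewrite edge_sumD edge_sumZ (edge_sum_const _ rG) -/E.
have -> : 2 * B `^ q * E = B `^ q * E + (B `^ (1 - q))^-1 * (B * E).
  have {4}-> : B = B `^ (1 - q) * B `^ q.
    by rewrite -powRD ?(gt_eqF B0) ?implybT// subrK powRr1 ?ltW.
  by field; rewrite gt_eqF.
by rewrite lerD2l ler_pM2l ?invr_gt0.
Qed.

(** From [2^-1 <= g] the factor (2 g)^(1/q) is at least 1, so it can be inserted into the Cheeger
    term to give both terms the same power of [g]. *)
Lemma unsnowflake_poincare (q g : R) : 0 < q < 1 -> 2^-1 <= g -> poincare_ineq M q G g ->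
  poincare_ineq M 1 G ((2 * 4 `^ q^-1 + d%:R / h * 2 `^ q^-1) * g `^ q^-1).
Proof.
move=> q01 g2 Pg f; have /andP[q0 q1] := q01.
have q01' : 0 < q <= 1 by rewrite q0 ltW.
have g0 : 0 < g by apply: lt_le_trans g2; rewrite invr_gt0.
set C := 2 * _ + _.
have C0 : 0 <= C by rewrite addr_ge0 ?mulr_ge0 ?divr_ge0 ?invr_ge0 ?powR_ge0 ?(ltW h0).
set e := edge_sum _.
have e0 : 0 <= e by apply: edge_sum_ge0 => v u; apply: powR_ge0.
(* B is not the mean edge length itself, which may be 0. *)
have bound B : 0 < B -> e <= B * E ->
    (n ^+ 2)^-1 * (\sum_v \sum_u mdist (f v) (f u) `^ 1) <= C * g `^ q^-1 * B.
  move=> B0 eB; have [v0] := poincare_ineq_center f g0 Pg.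
  have := edge_sum_powR_le q01 B0 eB.
  rewrite -ler_pdivrMr// => eqB center.
  have {}center : \sum_u mdist (f u) (f v0) `^ q <= n * (2 * g * B `^ q).
    apply: le_trans center _; rewrite ler_pM2l//.
    have -> : 2 * g * B `^ q = g * (2 * B `^ q) by ring.
    by rewrite ler_pM2l.
  (* The power [q] of [s] is twice the bound on the mean of rho^q, so Markov's inequality leaves at
     most half of the vertices beyond [s]. *)
  set s := (4 * g) `^ q^-1 * B.
  have s0 : 0 < s by rewrite mulr_gt0// powR_gt0// mulr_gt0.
  have sq : s `^ q = 4 * g * B `^ q.
    rewrite powRM ?powR_ge0 ?(ltW B0)// -powRrM mulVf ?gt_eqF// powRr1//.
    by rewrite mulr_ge0// ltW.
  have sm : (#|[set v | (s < mdist (f v) (f v0) `^ 1)%R]%SET|.*2 <= #|G|)%N.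
    rewrite -(ler_nat R) -muln2 natrM -(ler_pM2r (powR_gt0 q s0)).
    apply: (@le_trans _ _ (2 * \sum_u mdist (f u) (f v0) `^ q)).
      rewrite -[_ * 2]mulrC -mulrA ler_pM2l//; apply: markov_card => v.
        exact: powR_ge0.
      rewrite inE powRr1 ?mdist_ge0// => sv.
      by rewrite ge0_ler_powR ?nnegrE ?(ltW s0) ?mdist_ge0 ?(ltW q0) ?(ltW sv).
    by rewrite sq -/n; lra.
  have one01 : 0 < (1 : R) <= 1 by rewrite ltr01 lexx.
  have := cheeger_mdist (ltW h0) hG one01 sm.
  rewrite -/e -/n => sumf.
  have {}sumf : \sum_v mdist (f v) (f v0) `^ 1 <= n * (s + d%:R / h * B / 2).
    rewrite -(ler_pM2l h0); apply: le_trans sumf _.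
    have -> : h * (n * (s + d%:R / h * B / 2)) = h * (n * s) + B * (n * d%:R / 2).
      by field; rewrite gt_eqF.
    by rewrite lerD2l -EE [2 * E]mulrC mulfK.
  rewrite mulrC ler_pdivrMr ?exprn_gt0//.
  apply: le_trans (sum_mdist_center _ v0 one01) _; rewrite -/n.
  apply: (@le_trans _ _ (2 * n * (n * (s + d%:R / h * B / 2)))).
    by rewrite ler_pM2l ?mulr_gt0.
  have -> : C * g `^ q^-1 * B * n ^+ 2 = 2 * n * (n * (C * g `^ q^-1 * B / 2)) by field.
  rewrite ler_pM2l ?mulr_gt0// ler_pM2l//.
  have -> : C * g `^ q^-1 * B / 2 =
      s + d%:R / h * B / 2 * (2 * g) `^ q^-1.
    by rewrite /s /C !powRM ?(ltW g0)//; field; rewrite gt_eqF.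
  rewrite lerD2l ler_peMr ?mulr_ge0 ?invr_ge0 ?(ltW h0) ?(ltW B0)//.
  apply: (@le_trans _ _ (1 `^ q^-1)); first by rewrite powR1.
  rewrite ge0_ler_powR ?nnegrE ?mulr_ge0 ?invr_ge0 ?(ltW q0) ?(ltW g0)//.
  by lra.
set X := C * _ in bound *.
have X0 : 0 <= X by rewrite mulr_ge0 ?powR_ge0.
rewrite -/n -/E; apply/ler_addgt0Pr => t t0.
have X1 : 0 < X + 1 by apply: ltr_wpDl.
have tX : 0 < t / (X + 1) by rewrite divr_gt0.
(* The positive perturbation of the mean edge length costs X t / (X + 1), at most [t]. *)
apply: le_trans (bound (e / E + t / (X + 1)) _ _) _.
- by rewrite ltr_wpDl ?divr_ge0 ?(ltW E0).
- by rewrite mulrDl divfK ?gt_eqF// lerDl mulr_ge0 ?ltW.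
rewrite mulrDr mulrA [X / E * e]mulrAC lerD2l mulrA ler_pdivrMr// mulrDr mulr1 mulrC.
by rewrite lerDl ltW.
Qed.
End Directions.

(** * The infimum [gamma] and a lower bound for admissible constants *)

Section Gamma.
Context (R : realType) (M : metricType R) (G : sgraph).

Lemma poincare_ineq_le (p g g' : R) :
  g <= g' -> poincare_ineq M p G g -> poincare_ineq M p G g'.
Proof.
move=> gg' Pg f; apply: le_trans (Pg f) _.
apply: ler_wpM2r; first by apply: edge_sum_ge0 => v u; apply: powR_ge0.
by rewrite ler_wpM2r ?invr_ge0.
Qed.

Lemma gamma_ge0 (p : R) : (0 <= gamma M p G)%E.
Proof. by apply: le_ereal_inf_tmp => _ [g [g0 _] <-]; rewrite lee_fin ltW. Qed.

Lemma gamma_le (p g : R) : 0 < g -> poincare_ineq M p G g -> (gamma M p G <= g%:E)%E.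
Proof. by move=> g0 Pg; apply: ereal_inf_lbound; exists g. Qed.

Lemma gamma_lt (p : R) (x : \bar R) : (gamma M p G < x)%E ->
  exists g : R, [/\ 0 < g, poincare_ineq M p G g & (g%:E < x)%E].
Proof. by move=> /ereal_inf_lt[_ [g [g0 Pg] <-] gx]; exists g. Qed.

Lemma gamma_eq0 (p : R) : (forall g, 0 < g -> poincare_ineq M p G g) ->
  gamma M p G = 0%E.
Proof.
move=> P; apply/eqP; rewrite eq_le gamma_ge0 andbT.
apply/lee_addgt0Pr => t t0; rewrite add0e.
exact: gamma_le (P _ t0).
Qed.

(** Without vertices the prefactor is the inverse of 0, which is 0 by convention. *)
Lemma poincare_ineq_card0 (p g : R) : #|G| = 0%N -> 0 < g -> poincare_ineq M p G g.
Proof.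
move=> G0 g0 f; rewrite G0 expr0n invr0 mul0r mulr_ge0 ?divr_ge0 ?(ltW g0)//.
by apply: edge_sum_ge0 => v u; apply: powR_ge0.
Qed.

(* Test the inequality on the indicator function of one vertex. *)
Lemma poincare_ineq_ge_half (d : nat) (p g : R) (x y : M) :
  regular d G -> (0 < d)%N -> (0 < #|G|)%N -> p != 0 -> x != y ->
  poincare_ineq M p G g -> 2^-1 <= g.
Proof.
move=> rG d0 G0 p0 xy Pg; have /card_gt0P[v0 _] := G0.
have [u0 vu0] : exists u, adj v0 u.
  have /card_gt0P[u vu] : (0 < #|adj v0|)%N by rewrite rG.
  by exists u.
have G2 : (2 <= #|G|)%N.
  have := max_card (mem [set v0; u0]%SET); rewrite cards2.
  by case: eqVneq => // vu; rewrite vu adj_irrefl in vu0.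
set n : R := #|G|%:R; have n2 : 2 <= n by rewrite ler_nat.
have E2 : 2 * #|edges G|%:R = n * d%:R by rewrite -!natrM -(card_edges rG) mul2n.
have dR : 0 < d%:R :> R by rewrite ltr0n.
set r := mdist x y `^ p.
have r0 : 0 < r by rewrite powR_gt0// mdist_gt0.
pose f v := if v == v0 then x else y.
have fE v u : mdist (f v) (f u) `^ p = r * ((v == v0) != (u == v0))%:R.
  rewrite /f; case: (v == v0); case: (u == v0);
  by rewrite /= ?mulr1 ?mulr0 ?mdistxx ?powR0// /r metric_sym.
have sumE : \sum_(v : G | v != v0) r = r * (n - 1).
  rewrite sumr_const -mulr_natr; congr (_ * _).
  by rewrite /n -(prednK G0) mulrSr addrK -(cardC1 v0).
have lower : 2 * r * (n - 1) <= \sum_v \sum_u mdist (f v) (f u) `^ p.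
  have -> : 2 * r * (n - 1) = r * (n - 1) + r * (n - 1) by ring.
  rewrite -sumE [leRHS](bigD1 v0) //= lerD//.
    rewrite [leRHS](bigD1 v0) //= ler_wpDl ?powR_ge0//.
    by apply: ler_sum => u uv; rewrite fE eqxx (negbTE uv) mulr1.
  apply: ler_sum => v vv0; rewrite (bigD1 v0) //= fE eqxx (negbTE vv0) mulr1.
  by rewrite lerDl sumr_ge0// => u _; apply: powR_ge0.
have upper : edge_sum (fun v u => mdist (f v) (f u) `^ p) <= r * d%:R.
  have -> : r * d%:R = edge_sum (fun v u : G => r * ((v == v0)%:R + (u == v0)%:R)).
    rewrite edge_sumZ; congr (_ * _); rewrite edge_sumD /edge_sum.
    rewrite [X in _ + _ * X](exchange_big_dep predT) //=.
    have -> : \sum_v \sum_(u | adj v u) (v == v0)%:R = d%:R :> R.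
      rewrite (bigD1 v0) //= [X in _ + X]big1 ?addr0 ?eqxx ?sumr_const ?(rG v0)//.
      by move=> v /negbTE ->; rewrite big1.
    have -> : \sum_(v : G) \sum_(u | adj u v) (v == v0)%:R = d%:R :> R.
      rewrite (bigD1 v0) //= [X in _ + X]big1 ?addr0 ?eqxx.
        rewrite sumr_const -(rG v0); congr (_%:R); apply: eq_card => u.
        by rewrite !unfold_in /= adj_sym.
      by move=> v /negbTE ->; rewrite big1.
    by field.
  apply: le_edge_sum => v u _; rewrite fE ler_pM2l//.
  by case: (v == v0); case: (u == v0); rewrite /= ?addr0 ?add0r// ler_wpDl.
(* Positivity of [g] is not assumed: it follows from a positive left-hand side and a nonnegative
   edge sum. *)
have g0 : 0 < g / #|edges G|%:R.
  rewrite ltNge; apply/negP => gneg; have := Pg f.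
  have : 0 < (n ^+ 2)^-1 * (\sum_v \sum_u mdist (f v) (f u) `^ p).
    rewrite mulr_gt0 ?invr_gt0 ?exprn_gt0 ?(lt_le_trans _ lower) ?mulr_gt0//; lra.
  move=> /lt_le_trans H /H; rewrite ltNge mulr_le0_ge0//.
  by apply: edge_sum_ge0 => v u; apply: powR_ge0.
have nn : 0 < n by lra.
(* After cancellation this says (n - 1) / n <= g, and [n >= 2]. *)
have : (n ^+ 2)^-1 * (2 * r * (n - 1)) <= g / #|edges G|%:R * (r * d%:R).
  apply: (le_trans _ (le_trans (Pg f) _)); last by rewrite ler_pM2l.
  by rewrite ler_pM2l ?invr_gt0 ?exprn_gt0.
have -> : #|edges G|%:R = n * d%:R / 2 :> R by rewrite -E2; field.
have -> : (n ^+ 2)^-1 * (2 * r * (n - 1)) = 2 * r / n * ((n - 1) / n).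
  by field; rewrite gt_eqF.
have -> : g / (n * d%:R / 2) * (r * d%:R) = 2 * r / n * g.
  by field; rewrite !gt_eqF.
rewrite ler_pM2l ?divr_gt0 ?mulr_gt0//; apply: le_trans.
by rewrite ler_pdivlMr//; lra.
Qed.

End Gamma.

(** * Uniform comparison of the two constants, and the theorem *)

(** Both constants increase with the degree, so their values at [D] serve every [d <= D]. Assuming
    only a lower bound on the Cheeger constant lets one statement yield both halves of the
    theorem. *)
Lemma gamma_snowflake (R : realType) (D : nat) (eps h : R) :
  0 < eps -> eps < 1 -> 0 < h ->
  exists2 C : R, 0 < C & forall (M : metricType R) (G : sgraph) (d : nat),
    (3 <= d <= D)%N -> regular d G -> (h%:E <= cheeger R G)%E ->
    (gamma M (1 - eps) G <= C%:E * Order.max 1 (gamma M 1 G))%E /\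
    (gamma M 1 G <= C%:E * gamma M (1 - eps) G `^ (1 - eps)^-1)%E.
Proof.
move=> eps0 eps1 h0; set q := 1 - eps.
have q01 : 0 < q < 1 by apply/andP; split; rewrite /q; lra.
have /andP[q0 q1] := q01.
have K0 := cutoff_const_gt0 q.
pose C1 (d : nat) : R := 2 * (8 * cutoff_const q + 2 * (d%:R / h)).
pose C2 (d : nat) : R := 2 * 4 `^ q^-1 + d%:R / h * 2 `^ q^-1.
have C1_gt0 d : 0 < C1 d.
  by rewrite mulr_gt0// ltr_wpDr ?mulr_gt0// mulr_ge0// divr_ge0// ltW.
have C2_gt0 d : 0 < C2 d.
  by rewrite ltr_wpDr ?mulr_gt0 ?powR_gt0// mulr_ge0 ?powR_ge0// divr_ge0// ltW.
have C_gt0 : 0 < C1 D + C2 D by rewrite addr_gt0.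
exists (C1 D + C2 D) => // M G d /andP[d3 dD] rG hG.
have d0 : (0 < d)%N by apply: leq_trans d3.
have dh : d%:R / h <= D%:R / h by rewrite ler_wpM2r ?invr_ge0 ?(ltW h0) ?ler_nat.
have C1C : C1 d <= C1 D + C2 D.
  by rewrite ler_wpDr ?(ltW (C2_gt0 _))// /C1; lra.
have C2C : C2 d <= C1 D + C2 D.
  by rewrite ler_wpDl ?(ltW (C1_gt0 _))// /C2 lerD2l ler_wpM2r ?powR_ge0.
have RHS1 : (0 <= (C1 D + C2 D)%:E * Order.max 1 (gamma M 1 G))%E.
  by rewrite mule_ge0 ?lee_fin ?(ltW C_gt0)// le_max lee01.
have RHS2 : (0 <= (C1 D + C2 D)%:E * gamma M q G `^ q^-1)%E.
  by rewrite mule_ge0 ?lee_fin ?(ltW C_gt0)// poweR_ge0.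
move: (C1 D + C2 D) C_gt0 C1C C2C RHS1 RHS2 => C C_gt0 C1C C2C RHS1 RHS2.
have [G0|G0] := posnP #|G|.
  have gam0 p : gamma M p G = 0%E.
    by apply: gamma_eq0 => g; apply: poincare_ineq_card0.
  by rewrite !gam0 in RHS1 RHS2 *.
split.
  (* A failure would give [g] admissible for rho with C max(1, g) below [gamma M q G], while
     [snowflake_poincare] makes [C1 d * Num.max 1 g] admissible. Infinite values need no separate
     case. *)
  rewrite leNgt muleC -lte_pdivlMr//; apply/negP.
  rewrite gt_max => /andP[one_lt /gamma_lt[g [g0 Pg g_lt]]].
  have max0 : 0 < Num.max 1 g by rewrite lt_max ltr01.
  have := gamma_le (mulr_gt0 (C1_gt0 d) max0) (snowflake_poincare rG d0 G0 h0 hG q01 g0 Pg).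
  rewrite leNgt => /negP; apply.
  apply: (@le_lt_trans _ _ ((Num.max 1 g * C)%:E)).
    by rewrite lee_fin mulrC ler_wpM2l// ltW.
  rewrite EFinM -lte_pdivlMr// EFin_max gt_max one_lt; exact: g_lt.
(* The bound [2^-1 <= g] is obtained from two distinct points; otherwise all distances vanish and
   [gamma M 1 G] is 0. *)
have [[x [y xy]]|triv] := pselect (exists x y : M, x != y); last first.
  rewrite (gamma_eq0 (p := 1))// => g g0 f; rewrite big1 ?mulr0.
    rewrite mulr_ge0 ?divr_ge0 ?(ltW g0)//.
    by apply: edge_sum_ge0 => v u; apply: powR_ge0.
  move=> v _; rewrite big1// => u _; have -> : f v = f u.
    by apply/eqP; apply: contrapT => /negP fvu; apply: triv; exists (f v), (f u).
  by rewrite mdistxx powR0.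
have key g : 0 < g -> poincare_ineq M q G g -> (gamma M 1 G <= (C * g `^ q^-1)%:E)%E.
  move=> g0 Pg.
  have g2 := poincare_ineq_ge_half rG d0 G0 (lt0r_neq0 q0) xy Pg.
  apply: gamma_le; first by rewrite mulr_gt0 ?powR_gt0.
  apply: poincare_ineq_le (unsnowflake_poincare rG d0 G0 h0 hG q01 g2 Pg).
  by rewrite ler_wpM2r ?powR_ge0.
have := gamma_ge0 M G q; case E : (gamma M q G) => [t| |] t0; [|by rewrite poweRyr ?invr_neq0 ?(gt_eqF q0)// gt0_muley ?lte_fin// leey|by []].
rewrite lee_fin in t0; rewrite leNgt; apply/negP => lt.
(* A finite [gamma M q G] provides an admissible constant, hence [gamma M 1 G] is finite and real
   numbers can be compared. *)
have [g [g0 Pg g_lt]] : exists g : R, [/\ 0 < g, poincare_ineq M q G g & (g%:E < t%:E + 1)%E].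
  by apply: gamma_lt; rewrite E -EFinD lte_fin ltrDl.
have gam_fin : gamma M 1 G \is a fin_num.
  by rewrite ge0_fin_numE ?gamma_ge0// (le_lt_trans (key _ g0 Pg))// ltry.
move: key lt; rewrite -(fineK gam_fin) poweR_EFin -EFinM lte_fin.
set z := fine _ => key lt; clear g g0 Pg g_lt.
have z0 : 0 < z by apply: le_lt_trans lt; rewrite mulr_ge0 ?powR_ge0 ?(ltW C_gt0).
have zC : 0 <= z / C by rewrite divr_ge0 ?ltW.
(* The assumed strict inequality leaves room for an admissible [g] below (z / C)^q, for which [key]
   would give z <= C g^(1/q) < z. *)
have : (gamma M q G < ((z / C) `^ q)%:E)%E.
  rewrite E lte_fin.
  have -> : t = (t `^ q^-1) `^ q by rewrite -powRrM mulVf ?gt_eqF// powRr1.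
  by rewrite gt0_ltr_powR ?nnegrE ?powR_ge0// ltr_pdivlMr// mulrC.
move=> /gamma_lt[g [g0 Pg]]; rewrite lte_fin => gz.
have := key g g0 Pg; rewrite lee_fin leNgt => /negP; apply.
rewrite mulrC -ltr_pdivlMr//.
have -> : z / C = ((z / C) `^ q) `^ q^-1 by rewrite -powRrM mulfV ?gt_eqF// powRr1.
by rewrite gt0_ltr_powR ?invr_gt0 ?nnegrE ?powR_ge0 ?(ltW g0).
Qed.

Theorem corollary1p11 (R : realType) :
  (forall (d : nat) (eps h : R),
     (3 <= d)%N -> 0 < eps -> eps < 1 -> 0 < h ->
     exists c C : R, [/\ 0 < c, 0 < C &
       forall (M : metricType R) (G : sgraph),
         regular d G -> cheeger R G = h%:E ->
         (c%:E * gamma M (1 - eps) G <= Order.max 1 (gamma M 1 G))%E /\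
         (gamma M 1 G <= C%:E * gamma M (1 - eps) G `^ (1 - eps)^-1)%E])
  /\
  (forall (eps : R) (M : metricType R) (I : Type) (G : I -> sgraph),
     0 < eps -> eps < 1 ->
     (exists D : nat, forall i, exists d : nat,
        (3 <= d <= D)%N /\ regular d (G i)) ->
     (exists2 h0 : R, 0 < h0 & forall i, (h0%:E <= cheeger R (G i))%E) ->
     (ereal_sup (range (fun i => gamma M 1 (G i))) < +oo)%E <->
     (ereal_sup (range (fun i => gamma M (1 - eps) (G i))) < +oo)%E).
Proof.
split=> [d eps h d3 eps0 eps1 h0|eps M I G eps0 eps1 [D degG] [h h0 hG]].
  have [C C0 CP] := gamma_snowflake d eps0 eps1 h0.
  exists C^-1, C; split; rewrite ?invr_gt0// => M G rG hG.
  have dd : (3 <= d <= d)%N by rewrite d3 leqnn.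
  have hle : (h%:E <= cheeger R G)%E by rewrite hG.
  have [H1 H2] := CP M G d dd rG hle; split=> //.
  by rewrite muleC lee_pdivrMr// muleC.
have [C C0 CP] := gamma_snowflake D eps0 eps1 h0.
have {}CP i : (gamma M (1 - eps) (G i) <= C%:E * Order.max 1 (gamma M 1 (G i)))%E /\
    (gamma M 1 (G i) <= C%:E * gamma M (1 - eps) (G i) `^ (1 - eps)^-1)%E.
  by have [d [dD rG]] := degG i; apply: CP dD rG (hG i).
split; set B := ereal_sup _ => By.
  apply: (@le_lt_trans _ _ (C%:E * Order.max 1 B)%E); last first.
    by rewrite lte_mul_pinfty ?lee_fin ?(ltW C0)// gt_max ltry.
  apply: ge_ereal_sup => _ [i _ <-]; apply: le_trans (CP i).1 _.
  rewrite lee_wpmul2l ?lee_fin ?(ltW C0)// ge_max !le_max lexx /=.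
  by apply/orP; right; apply: ereal_sup_ubound; exists i.
(* For an empty family [B] is -oo; the maximum with 0 keeps the base where the power is monotone. *)
apply: (@le_lt_trans _ _ (C%:E * Order.max 0 B `^ (1 - eps)^-1)%E); last first.
  by rewrite lte_mul_pinfty ?lee_fin ?(ltW C0)// poweR_lty// gt_max ltry.
apply: ge_ereal_sup => _ [i _ <-]; apply: le_trans (CP i).2 _.
rewrite lee_wpmul2l ?lee_fin ?(ltW C0)// gt0_ler_poweR ?invr_ge0 ?subr_ge0 ?(ltW eps1)//.
- by rewrite in_itv /= gamma_ge0 leey.
- by rewrite in_itv /= le_max lexx leey.
- by rewrite le_max; apply/orP; right; apply: ereal_sup_ubound; exists i.
Qed.
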